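(* Let $(g,m,m)$ be one of the triples $(1,m,m)$, $(2,m,m)$ with $m$ a positive integer, $(3,1,1)$, $(3,2,2)$, $(3,4,4)$, $(3,8,8)$, $(4,1,1)$, $(4,2,2)$, $(6,1,1)$, $(6,2,2)$. The spectral problem $$\xi''(x)-(m-1)\tanh(x)\,\xi'(x)-m\tanh^2(x)\,\xi(x)+\Big(\lambda+m-\frac{m}{g}\Big)\frac{\xi(x)}{\cosh^2(x)}=0,\qquad x\in\mathbb{R},$$ describing the equivariant stability of the linear solution $r(t)=(1-2g)t$ for the special orthogonal group, parametrized by $r(x)=\frac{1-2g}{g}\arctan(e^x)$, is solved by $$\xi_j(x)=\frac{1}{\cosh(x)}\,C^{\left(\frac{m+2}{2}\right)}_{j-1}\big(\tanh(x)\big),\qquad \lambda_j=j(j+m)+\frac{m}{g}-2m,$$ where $j\in\{1,2,3,\dots\}$.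
   Context: Origin of the problem: an isometric cohomogeneity one action $G\times\mathbb{S}^{n+1}\to\mathbb{S}^{n+1}$ with data $(g,m,m)$ ($g$ the number of distinct principal curvatures of the principal orbits, all of multiplicity $m$, $n=gm$) lifts to an isometric cohomogeneity one action of $G\times\mathrm{SO}(n+1)$ on $\mathrm{SO}(n+2)$. Equivariant self-maps of $\mathrm{SO}(n+2)$ given by a function $r$ on $[0,\frac{\pi}{2g}]$ have (with $m_0=m_1=m$) Jacobi equation $$\ddot\xi+\tfrac{2gm\cos(2gt)}{\sin(2gt)}\dot\xi-\tfrac{2gm}{\sin^2(2gt)}\Big[(2g-2)\cos(2(r(t)-t))+2\cos(2(r(t)-t)+2gt)\cos(2gt)\Big]\xi+\lambda\xi=0.$$ For the harmonic self-map with $r(t)=(1-2g)t$ (which exists only when $m_0=m_1$) the change of variables $t=\frac1g\arctan(e^x)$, with $\lambda$ rescaled by the factor $4g^2$, gives the spectral problem of the claim. $C_k^{(\delta)}$, $k\ge0$, denotes the Gegenbauer polynomial of degree $k$, a polynomial solution of $(1-y^2)f''(y)-(2\delta+1)yf'(y)+k(k+2\delta)f(y)=0$, given by $C_0^{(\delta)}=1$, $C_1^{(\delta)}(y)=2\delta y$ and $C_k^{(\delta)}(y)=\frac1k\big(2y(k+\delta-1)C_{k-1}^{(\delta)}(y)-(k+2\delta-2)C_{k-2}^{(\delta)}(y)\big)$ for $k\ge2$. *)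

(* Defs.v *)
From Stdlib Require Import Reals.
From Coquelicot Require Import Coquelicot.

Open Scope R_scope.

(* The data (g, m, m). *)
Definition admissible (g m : nat) : Prop :=
  (g = 1%nat /\ (1 <= m)%nat) \/
  (g = 2%nat /\ (1 <= m)%nat) \/
  (g = 3%nat /\ (m = 1 \/ m = 2 \/ m = 4 \/ m = 8)%nat) \/
  (g = 4%nat /\ (m = 1 \/ m = 2)%nat) \/
  (g = 6%nat /\ (m = 1 \/ m = 2)%nat).

(* In the last branch k >= 2, k1 = k - 1 and k2 = k - 2. *)
Fixpoint gegenbauer (delta : R) (k : nat) (y : R) : R :=
  match k with
  | O => 1
  | S k1 =>
      match k1 with
      | O => 2 * delta * y
      | S k2 =>
          1 / INR k *
          (2 * y * (INR k + delta - 1) * gegenbauer delta k1 y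
           - (INR k + 2 * delta - 2) * gegenbauer delta k2 y)
      end
  end.

(* Derive is total, so differentiability has to be required separately. *)
Definition twice_derivable (f : R -> R) (x : R) : Prop :=
  ex_derive f x /\ ex_derive (Derive f) x.

(* The Jacobi equation at the equivariant self-map of SO(n+2) given by r. *)
Definition solves_jacobi (g m : nat) (r : R -> R) (lambda : R) (xi : R -> R)
    : Prop :=
  let G := INR g in
  let M := INR m in
  forall t : R, 0 < t < PI / (2 * G) ->
    twice_derivable xi t /\
    Derive (Derive xi) t
    + 2 * G * M * cos (2 * G * t) / sin (2 * G * t) * Derive xi t
    - 2 * G * M / (sin (2 * G * t)) ^ 2
      * ((2 * G - 2) * cos (2 * (r t - t))
         + 2 * cos (2 * (r t - t) + 2 * G * t) * cos (2 * G * t)) * xi t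
    + lambda * xi t = 0.

Definition linear_solution (g : nat) (t : R) : R := (1 - 2 * INR g) * t.

(* The change of variables, a bijection from R onto (0, PI / (2 g)). *)
Definition t_of_x (g : nat) (x : R) : R := 1 / INR g * atan (exp x).

Definition solves_spectral_ode (g m : nat) (lambda : R) (xi : R -> R) : Prop :=
  let G := INR g in
  let M := INR m in
  forall x : R,
    twice_derivable xi x /\
    Derive (Derive xi) x - (M - 1) * tanh x * Derive xi x
    - M * (tanh x) ^ 2 * xi x
    + (lambda + M - M / G) * (xi x / (cosh x) ^ 2) = 0.

(* The zero function solves the equation for every lambda and is excluded. *)
Definition solves_spectral_problem (g m : nat) (lambda : R) (xi : R -> R)
    : Prop :=
  solves_spectral_ode g m lambda xi /\ exists x : R, xi x <> 0.

(* Main.v *)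
(** With [y = tanh x] and [w = 1 - y^2], the ansatz [xi = P(tanh x) / cosh x]
    turns the spectral ODE into the Gegenbauer equation for [P] with parameter
    [(m + 2) / 2] and degree [j - 1]. The Gegenbauer equation follows from two
    first-order relations between consecutive polynomials, which are proved
    together by induction from the three-term recurrence. The solutions are
    nonzero because the value of a Gegenbauer polynomial at 1 is positive.

    For the change of variables, [2 g t = 2 atan (exp x)] gives
    [sin (2 g t) = 1 / cosh x], [cos (2 g t) = - tanh x] and
    [dt/dx = 1 / (2 g cosh x)], so that the Jacobi operator is
    [4 g^2 cosh^2 x] times the spectral operator. *)

Require Import Defs.
From Stdlib Require Import Reals Lra Lia.
From Coquelicot Require Import Coquelicot.

Open Scope R_scope.

(** * Hyperbolic functions: identities, derivatives and the range of [tanh] *)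

Lemma cosh_pos (x : R) : 0 < cosh x.
Proof.
  unfold cosh. generalize (exp_pos x) (exp_pos (- x)). lra.
Qed.

Lemma cosh2_tanh2 (x : R) : (cosh x) ^ 2 * (1 - tanh x ^ 2) = 1.
Proof.
  assert (H := cosh_pos x). unfold tanh.
  replace (cosh x ^ 2 * (1 - (sinh x / cosh x) ^ 2))
    with (cosh x ^ 2 - sinh x ^ 2) by (field; lra).
  unfold cosh, sinh.
  assert (E : exp x * exp (- x) = 1) by (rewrite <- exp_plus, Rplus_opp_r; apply exp_0).
  nra.
Qed.

Lemma inv_cosh2 (x : R) : / (cosh x) ^ 2 = 1 - tanh x ^ 2.
Proof.
  assert (H := cosh_pos x).
  apply Rmult_eq_reg_l with (cosh x ^ 2); [|apply pow_nonzero; lra].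
  rewrite cosh2_tanh2. field. lra.
Qed.

Lemma is_derive_cosh (x : R) : is_derive cosh x (sinh x).
Proof. apply is_derive_Reals, derivable_pt_lim_cosh. Qed.

Lemma is_derive_sinh (x : R) : is_derive sinh x (cosh x).
Proof. apply is_derive_Reals, derivable_pt_lim_sinh. Qed.

Lemma is_derive_inv_cosh (x : R) :
  is_derive (fun x => 1 / cosh x) x (- (1 / cosh x * tanh x)).
Proof.
  assert (H := cosh_pos x).
  evar_last.
  { apply is_derive_div;
      [apply is_derive_const | apply is_derive_cosh | lra]. }
  unfold zero, tanh; simpl. field. lra.
Qed.

Lemma is_derive_tanh (x : R) : is_derive tanh x (1 - tanh x ^ 2).
Proof.
  assert (H := cosh_pos x).
  unfold tanh. evar_last.
  { apply is_derive_div;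
      [apply is_derive_sinh | apply is_derive_cosh | lra]. }
  field. lra.
Qed.

Lemma tanh_surjective (y : R) : -1 < y < 1 -> exists x : R, tanh x = y.
Proof.
  (* The witness is the closed form of artanh. *)
  intros Hy. exists (ln ((1 + y) / (1 - y)) / 2).
  set (x := _ / 2).
  assert (E : exp x * exp x = (1 + y) / (1 - y)).
  { rewrite <- exp_plus. replace (x + x) with (ln ((1 + y) / (1 - y)))
      by (unfold x; field).
    apply exp_ln, Rdiv_lt_0_compat; lra. }
  assert (E' : exp x * exp x * (1 - y) = 1 + y) by (rewrite E; field; lra).
  assert (P := exp_pos x).
  unfold tanh, sinh, cosh. rewrite exp_Ropp.
  replace ((exp x - / exp x) / 2 / ((exp x + / exp x) / 2))
    with ((exp x * exp x - 1) / (exp x * exp x + 1)) by (field; split; nra).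
  rewrite E. field. split; lra.
Qed.

(** * Gegenbauer polynomials: recurrence, derivative relations, differential equation, positivity at
    1 *)

Lemma gegenbauer_SS (delta : R) (k : nat) (y : R) :
  INR (S (S k)) * gegenbauer delta (S (S k)) y =
  2 * y * (INR (S k) + delta) * gegenbauer delta (S k) y
  - (INR k + 2 * delta) * gegenbauer delta k y.
Proof.
  change (gegenbauer delta (S (S k)) y) with
    (1 / INR (S (S k)) *
     (2 * y * (INR (S (S k)) + delta - 1) * gegenbauer delta (S k) y
      - (INR (S (S k)) + 2 * delta - 2) * gegenbauer delta k y)).
  assert (H := pos_INR k). rewrite !S_INR. field. lra.
Qed.

Lemma gegenbauer_SS_div (delta : R) (k : nat) (y : R) :
  gegenbauer delta (S (S k)) y =
  (2 * y * (INR (S k) + delta) * gegenbauer delta (S k) y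
   - (INR k + 2 * delta) * gegenbauer delta k y) / INR (S (S k)).
Proof.
  rewrite <- gegenbauer_SS. field. apply not_0_INR. lia.
Qed.

Lemma is_derive_three_term (p q : R -> R) (a b n y : R) :
  ex_derive p y -> ex_derive q y ->
  is_derive (fun z => (2 * z * a * p z - b * q z) / n) y
    ((2 * a * (p y + y * Derive p y) - b * Derive q y) / n).
Proof.
  intros Hp Hq. auto_derive; [repeat split; assumption|].
  change (Derive (fun x => p x) y) with (Derive p y).
  change (Derive (fun x => q x) y) with (Derive q y).
  unfold Rdiv. ring.
Qed.

Lemma ex_derive_gegenbauer (delta : R) (k : nat) (y : R) :
  ex_derive (gegenbauer delta k) y.
Proof.
  (* The recurrence reaches back two degrees, so the induction carries two consecutive ones. *)
  enough (H : ex_derive (gegenbauer delta k) y /\ ex_derive (gegenbauer delta (S k)) y)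
    by apply H.
  induction k as [|k [IH0 IH1]].
  - split; simpl; auto_derive; trivial.
  - split; [exact IH1|].
    eapply ex_derive_ext.
    { intros z. symmetry. apply gegenbauer_SS_div. }
    eexists. apply is_derive_three_term; assumption.
Qed.

Lemma Derive_gegenbauer_SS (delta : R) (k : nat) (y : R) :
  INR (S (S k)) * Derive (gegenbauer delta (S (S k))) y =
  2 * (INR (S k) + delta) *
    (gegenbauer delta (S k) y + y * Derive (gegenbauer delta (S k)) y)
  - (INR k + 2 * delta) * Derive (gegenbauer delta k) y.
Proof.
  rewrite (Derive_ext _ _ y (gegenbauer_SS_div delta k)).
  erewrite is_derive_unique.
  2:{ apply is_derive_three_term; apply ex_derive_gegenbauer. }
  field. apply not_0_INR. lia.
Qed.

(** The two relations feed each other. In the induction step, the first comes from the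
    differentiated recurrence after eliminating the derivative of lowest degree with the old second
    relation. The second comes from the recurrence itself and both old relations. *)
Lemma Derive_gegenbauer_relations (delta : R) (k : nat) (y : R) :
  Derive (gegenbauer delta (S k)) y =
    y * Derive (gegenbauer delta k) y + (INR k + 2 * delta) * gegenbauer delta k y /\
  INR (S k) * gegenbauer delta (S k) y =
    y * Derive (gegenbauer delta (S k)) y - Derive (gegenbauer delta k) y.
Proof.
  induction k as [|k [IH1 IH2]].
  - assert (D0 : Derive (gegenbauer delta 0) y = 0) by exact (Derive_const 1 y).
    assert (D1 : Derive (gegenbauer delta 1) y = 2 * delta).
    { apply is_derive_unique. simpl. auto_derive; trivial. ring. }
    rewrite D0, D1. simpl. split; ring.
  - assert (HD := Derive_gegenbauer_SS delta k y).
    assert (HP := gegenbauer_SS delta k y).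
    assert (Hk := pos_INR k).
    assert (E : Derive (gegenbauer delta (S (S k))) y =
      y * Derive (gegenbauer delta (S k)) y
      + (INR (S k) + 2 * delta) * gegenbauer delta (S k) y).
    { apply Rmult_eq_reg_l with (INR (S (S k))); [|apply not_0_INR; lia].
      rewrite HD.
      replace (Derive (gegenbauer delta k) y) with
        (y * Derive (gegenbauer delta (S k)) y
         - INR (S k) * gegenbauer delta (S k) y) by lra.
      rewrite !S_INR. ring. }
    split; [exact E|].
    rewrite HP, E.
    replace ((INR k + 2 * delta) * gegenbauer delta k y) with
      (Derive (gegenbauer delta (S k)) y - y * Derive (gegenbauer delta k) y) by lra.
    replace (Derive (gegenbauer delta k) y) with
      (y * Derive (gegenbauer delta (S k)) y
       - INR (S k) * gegenbauer delta (S k) y) by lra.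
    ring.
Qed.

(** The first derivative relation expresses each derivative through the previous polynomial and its
    derivative, which makes a simple induction work. *)
Lemma ex_derive_Derive_gegenbauer (delta : R) (k : nat) (y : R) :
  ex_derive (Derive (gegenbauer delta k)) y.
Proof.
  induction k as [|k IH].
  - apply ex_derive_ext with (fun _ => 0); [|apply ex_derive_const].
    intros z. symmetry. apply (Derive_const 1).
  - eapply ex_derive_ext.
    { intros z. symmetry. apply Derive_gegenbauer_relations. }
    assert (H := ex_derive_gegenbauer delta k y).
    auto_derive. repeat split; assumption || trivial.
Qed.

Lemma is_derive_two_term (p q : R -> R) (a b y : R) :
  ex_derive p y -> ex_derive q y ->
  is_derive (fun z => a * z * p z + b * q z) y
    (a * (p y + y * Derive p y) + b * Derive q y).
Proof.
  intros Hp Hq. auto_derive; [repeat split; assumption|].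
  change (Derive (fun x => p x) y) with (Derive p y).
  change (Derive (fun x => q x) y) with (Derive q y).
  ring.
Qed.

Lemma is_derive_one_minus_sqr_mult (p : R -> R) (y : R) :
  ex_derive p y ->
  is_derive (fun z => (1 - z ^ 2) * p z) y
    ((1 - y ^ 2) * Derive p y - 2 * y * p y).
Proof.
  intros Hp. auto_derive; [repeat split; assumption|].
  change (Derive (fun x => p x) y) with (Derive p y).
  ring.
Qed.

(** The two derivative relations combine into a formula for (1 - y^2) P' in terms of P and the
    previous polynomial Q. Differentiating it once more and removing Q' with the second relation
    leaves an equation in P alone. *)
Lemma gegenbauer_ode (delta : R) (k : nat) (y : R) :
  (1 - y ^ 2) * Derive (Derive (gegenbauer delta k)) y
  - (2 * delta + 1) * y * Derive (gegenbauer delta k) y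
  + INR k * (INR k + 2 * delta) * gegenbauer delta k y = 0.
Proof.
  destruct k as [|k].
  { assert (D : forall z, Derive (gegenbauer delta 0) z = 0) by exact (Derive_const 1).
    rewrite (Derive_ext _ _ y D), Derive_const, D.
    simpl. ring. }
  set (P := gegenbauer delta (S k)). set (Q := gegenbauer delta k).
  assert (A : forall z, (1 - z ^ 2) * Derive P z =
                 - INR (S k) * z * P z + (INR k + 2 * delta) * Q z).
  { intros z. destruct (Derive_gegenbauer_relations delta k z) as [E1 E2].
    fold P Q in E1, E2.
    replace (- INR (S k) * z * P z) with (- z * (INR (S k) * P z)) by ring.
    rewrite E2.
    replace ((INR k + 2 * delta) * Q z) with (Derive P z - z * Derive Q z) by lra.
    ring. }
  assert (BL := is_derive_one_minus_sqr_mult (Derive P) y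
                  (ex_derive_Derive_gegenbauer delta (S k) y)).
  assert (BR := is_derive_two_term P Q (- INR (S k)) (INR k + 2 * delta) y
                  (ex_derive_gegenbauer delta (S k) y) (ex_derive_gegenbauer delta k y)).
  assert (B := eq_trans (eq_sym (is_derive_unique _ _ _ BL))
                 (eq_trans (Derive_ext _ _ y A) (is_derive_unique _ _ _ BR))).
  destruct (Derive_gegenbauer_relations delta k y) as [_ E2]. fold P Q in E2.
  replace (Derive Q y) with (y * Derive P y - INR (S k) * P y) in B by lra.
  rewrite S_INR in *. lra.
Qed.

(** At y = 1 the three-term recurrence collapses to a two-term one with positive coefficients, which
    is carried along in the induction. *)
Lemma gegenbauer_1_pos (delta : R) (k : nat) :
  0 < delta -> 0 < gegenbauer delta k 1.
Proof.
  intros Hd.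
  enough (H : 0 < gegenbauer delta k 1 /\
              INR (S k) * gegenbauer delta (S k) 1
              = (INR k + 2 * delta) * gegenbauer delta k 1) by apply H.
  induction k as [|k [IH1 IH2]].
  - simpl. split; lra.
  - assert (Hk := pos_INR k).
    assert (HP := gegenbauer_SS delta k 1).
    split.
    + rewrite S_INR in IH2.
      apply Rmult_lt_reg_l with (INR k + 1); [lra|].
      rewrite IH2, Rmult_0_r. apply Rmult_lt_0_compat; lra.
    + rewrite HP, <- IH2, S_INR. ring.
Qed.

(** Since [tanh] never takes the value 1, positivity at 1 is moved by continuity to a nearby point
    that [tanh] does reach. *)
Lemma gegenbauer_tanh_neq0 (delta : R) (k : nat) :
  0 < delta -> exists x : R, gegenbauer delta k (tanh x) <> 0.
Proof.
  intros Hd.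
  assert (C : continuous (gegenbauer delta k) 1)
    by exact (ex_derive_continuous _ _ (ex_derive_gegenbauer delta k 1)).
  destruct (C _ (open_gt 0 _ (gegenbauer_1_pos delta k Hd))) as [e He].
  assert (He0 := cond_pos e).
  (* Below e, to stay in the neighbourhood of positivity; below 1, so that 1 - h lies in the range
     of [tanh]. *)
  set (h := Rmin e 1 / 2).
  assert (0 < h /\ h < e /\ h < 1).
  { unfold h. generalize (Rmin_l e 1) (Rmin_r e 1) (Rmin_pos e 1 He0 Rlt_0_1). lra. }
  destruct (tanh_surjective (1 - h)) as [x Hx]; [lra|].
  exists x. rewrite Hx. apply Rgt_not_eq, He.
  change (Rabs (1 - h - 1) < e).
  rewrite Rabs_left; lra.
Qed.

(** * The explicit solutions of the spectral problem *)

Lemma is_derive_gegenbauer_tanh (delta : R) (k : nat) (x : R) :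
  is_derive (fun x => gegenbauer delta k (tanh x)) x
    ((1 - tanh x ^ 2) * Derive (gegenbauer delta k) (tanh x)).
Proof.
  apply (is_derive_comp (gegenbauer delta k) tanh).
  - apply Derive_correct, ex_derive_gegenbauer.
  - apply is_derive_tanh.
Qed.

Lemma is_derive_Derive_gegenbauer_tanh (delta : R) (k : nat) (x : R) :
  is_derive (fun x => Derive (gegenbauer delta k) (tanh x)) x
    ((1 - tanh x ^ 2) * Derive (Derive (gegenbauer delta k)) (tanh x)).
Proof.
  apply (is_derive_comp (Derive (gegenbauer delta k)) tanh).
  - apply Derive_correct, ex_derive_Derive_gegenbauer.
  - apply is_derive_tanh.
Qed.

Lemma spectral_solution (g m j : nat) :
  (1 <= j)%nat ->
  solves_spectral_problem g m
    (INR j * (INR j + INR m) + INR m / INR g - 2 * INR m)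
    (fun x => 1 / cosh x * gegenbauer ((INR m + 2) / 2) (j - 1) (tanh x)).
Proof.
  intros Hj. set (d := (INR m + 2) / 2).
  assert (Hd : 0 < d) by (unfold d; generalize (pos_INR m); lra).
  destruct j as [|k]; [lia|].
  replace (S k - 1)%nat with k by lia.
  split.
  2:{ destruct (gegenbauer_tanh_neq0 d k Hd) as [x Hx]. exists x.
      apply Rmult_integral_contrapositive_currified; [|exact Hx].
      apply Rgt_not_eq, Rdiv_lt_0_compat; [lra | apply cosh_pos]. }
  set (P := gegenbauer d k). set (xi := fun x => 1 / cosh x * P (tanh x)).
  pose (xi1 := fun x => 1 / cosh x *
                  ((1 - tanh x ^ 2) * Derive P (tanh x) - tanh x * P (tanh x))).
  assert (H1 : forall x, is_derive xi x (xi1 x)).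
  { intros x. evar_last.
    { apply (is_derive_mult (K := R_AbsRing) (fun x => 1 / cosh x)
               (fun x => P (tanh x))).
      - apply is_derive_inv_cosh.
      - apply is_derive_gegenbauer_tanh.
      - exact Rmult_comm. }
    unfold mult, plus; simpl. fold P. unfold xi1. ring. }
  assert (H2 : forall x, is_derive (Derive xi) x
    (1 / cosh x *
     ((1 - tanh x ^ 2) ^ 2 * Derive (Derive P) (tanh x)
      - 4 * tanh x * (1 - tanh x ^ 2) * Derive P (tanh x)
      + (2 * tanh x ^ 2 - 1) * P (tanh x)))).
  { intros x. apply is_derive_ext with xi1.
    { intros z. symmetry. apply is_derive_unique, H1. }
    assert (T := is_derive_tanh x).
    assert (DP := is_derive_gegenbauer_tanh d k x).
    assert (DD := is_derive_Derive_gegenbauer_tanh d k x). fold P in DP, DD.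
    evar_last.
    { apply (is_derive_mult (K := R_AbsRing) (fun x => 1 / cosh x)
        (fun x => (1 - tanh x ^ 2) * Derive P (tanh x) - tanh x * P (tanh x))).
      - apply is_derive_inv_cosh.
      - apply (is_derive_minus (K := R_AbsRing)
          (fun x => (1 - tanh x ^ 2) * Derive P (tanh x))
          (fun x => tanh x * P (tanh x))).
        + apply (is_derive_mult (K := R_AbsRing) (fun x => 1 - tanh x ^ 2)
            (fun x => Derive P (tanh x))).
          * apply (is_derive_minus (K := R_AbsRing) (fun _ => 1) (fun x => tanh x ^ 2)).
            -- apply is_derive_const.
            -- apply is_derive_pow, T.
          * exact DD.
          * exact Rmult_comm.
        + apply (is_derive_mult (K := R_AbsRing) tanh (fun x => P (tanh x)));
            [exact T | exact DP | exact Rmult_comm].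
      - exact Rmult_comm. }
    unfold mult, plus, minus, opp, zero; simpl. unfold plus, opp; simpl. ring. }
  intros x. split.
  { split; [exists (xi1 x); apply H1 | eexists; apply H2]. }
  rewrite (is_derive_unique _ _ _ (H2 x)), (is_derive_unique _ _ _ (H1 x)).
  (* The sixth division is the outer one in [xi x / (cosh x) ^ 2]. *)
  unfold xi1, xi, Rdiv at 6. rewrite inv_cosh2.
  assert (E := gegenbauer_ode d k (tanh x)). fold P in E.
  rewrite S_INR.
  (* With j = k + 1 and 2d = m + 2, the coefficient lambda + m - m/g equals k(k + 2d) + 1. The
     remaining terms in P add up to -(1 - y^2) P, which cancels the extra 1 and leaves the
     Gegenbauer operator. *)
  match goal with |- ?L = 0 => replace L with (1 / cosh x * (1 - tanh x ^ 2) *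
    ((1 - tanh x ^ 2) * Derive (Derive P) (tanh x)
     - (2 * d + 1) * tanh x * Derive P (tanh x)
     + INR k * (INR k + 2 * d) * P (tanh x))) end.
  { rewrite E. ring. }
  (* With m/g and 1/cosh x as atoms the identity is polynomial, and m/g cancels. *)
  unfold d. set (q := INR m / INR g). set (s := 1 / cosh x). field.
Qed.

(** * The change of variables between t and x *)

Lemma derive_comp_twice (f h h1 : R -> R) (h2 t : R) :
  locally t (fun s => ex_derive f (h s)) ->
  ex_derive (Derive f) (h t) ->
  locally t (fun s => is_derive h s (h1 s)) ->
  is_derive h1 t h2 ->
  is_derive (fun s => f (h s)) t (h1 t * Derive f (h t)) /\
  is_derive (Derive (fun s => f (h s))) t
    (h1 t ^ 2 * Derive (Derive f) (h t) + h2 * Derive f (h t)).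
Proof.
  intros Hf Hf2 Hh Hh2.
  (* The first derivative is needed on a whole neighbourhood in order to be differentiated again. *)
  assert (D : locally t (fun s => is_derive (fun s => f (h s)) s (h1 s * Derive f (h s)))).
  { generalize (filter_and _ _ Hf Hh). apply filter_imp. intros s [A B].
    apply (is_derive_comp f h); [apply Derive_correct, A | exact B]. }
  split; [exact (locally_singleton _ _ D)|].
  apply is_derive_ext_loc with (fun s => h1 s * Derive f (h s)).
  { generalize D. apply filter_imp. intros s A. symmetry.
    apply is_derive_unique, A. }
  evar_last.
  { apply (is_derive_mult (K := R_AbsRing) h1 (fun s => Derive f (h s))).
    - exact Hh2.
    - apply (is_derive_comp (Derive f) h).
      + apply Derive_correct, Hf2.
      + exact (locally_singleton _ _ Hh).
    - exact Rmult_comm. }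
  unfold mult, plus, scal; simpl. unfold mult; simpl. ring.
Qed.

Lemma t_of_x_bounds (g : nat) (x : R) :
  (0 < g)%nat -> 0 < t_of_x g x < PI / (2 * INR g).
Proof.
  intros Hg. apply lt_0_INR in Hg. unfold t_of_x.
  assert (B := atan_bound (exp x)).
  assert (P : 0 < atan (exp x)) by (rewrite <- atan_0; apply atan_increasing, exp_pos).
  split.
  - apply Rmult_lt_0_compat; [apply Rdiv_lt_0_compat|]; lra.
  - replace (PI / (2 * INR g)) with (1 / INR g * (PI / 2)) by (field; lra).
    apply Rmult_lt_compat_l; [apply Rdiv_lt_0_compat|]; lra.
Qed.

(** With u = exp x, the double-angle formulas at atan u give 2u / (1 + u^2) and (1 - u^2) / (1 +
    u^2). *)
Lemma sin_cos_t_of_x (g : nat) (x : R) :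
  (0 < g)%nat ->
  sin (2 * INR g * t_of_x g x) = 1 / cosh x /\
  cos (2 * INR g * t_of_x g x) = - tanh x.
Proof.
  intros Hg. apply lt_0_INR in Hg. unfold t_of_x.
  replace (2 * INR g * (1 / INR g * atan (exp x)))
    with (2 * atan (exp x)) by (field; lra).
  rewrite sin_2a, cos_2a, sin_atan, cos_atan.
  assert (P := exp_pos x). unfold Rsqr.
  set (u := exp x) in *.
  assert (S : sqrt (1 + u * u) * sqrt (1 + u * u) = 1 + u * u) by (apply sqrt_sqrt; nra).
  assert (S0 : 0 < sqrt (1 + u * u)) by (apply sqrt_lt_R0; nra).
  unfold tanh, sinh, cosh. rewrite exp_Ropp. fold u.
  set (q := sqrt (1 + u * u)) in *.
  split.
  - replace (2 * (u / q) * (1 / q)) with (2 * u / (q * q)) by (field; lra).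
    rewrite S. field. split; nra.
  - replace (1 / q * (1 / q) - u / q * (u / q)) with ((1 - u * u) / (q * q))
      by (field; lra).
    rewrite S. field. split; nra.
Qed.

Lemma is_derive_t_of_x (g : nat) (x : R) :
  (0 < g)%nat -> is_derive (t_of_x g) x (1 / (2 * INR g) * (1 / cosh x)).
Proof.
  intros Hg. apply lt_0_INR in Hg. unfold t_of_x.
  assert (P := exp_pos x).
  auto_derive; [trivial|].
  unfold cosh, Rsqr. rewrite exp_Ropp. field. repeat split; nra.
Qed.

Lemma is_derive_inv_cosh_scaled (c x : R) :
  is_derive (fun x => c * (1 / cosh x)) x (- (c * (1 / cosh x) * tanh x)).
Proof.
  evar_last.
  { apply (is_derive_scal (fun x => 1 / cosh x)), is_derive_inv_cosh. }
  ring.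
Qed.

Lemma twice_derivable_t_of_x (g : nat) (xi : R -> R) :
  (0 < g)%nat ->
  (forall t, 0 < t < PI / (2 * INR g) -> twice_derivable xi t) ->
  forall x,
    let eta := fun x => xi (t_of_x g x) in
    let c := 1 / (2 * INR g) * (1 / cosh x) in
    is_derive eta x (c * Derive xi (t_of_x g x)) /\
    is_derive (Derive eta) x
      (c ^ 2 * Derive (Derive xi) (t_of_x g x)
       + - (c * tanh x) * Derive xi (t_of_x g x)).
Proof.
  intros Hg H x.
  apply derive_comp_twice with (h1 := fun x => 1 / (2 * INR g) * (1 / cosh x)).
  - apply filter_forall. intros z. apply H, t_of_x_bounds, Hg.
  - apply H, t_of_x_bounds, Hg.
  - apply filter_forall. intros z. apply is_derive_t_of_x, Hg.
  - apply is_derive_inv_cosh_scaled.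
Qed.

(** The inverse of [t_of_x], meaningful only for 0 < t < PI / (2g). It serves to carry regularity
    from the x variable back to t. *)
Definition x_of_t (g : nat) (t : R) : R := ln (tan (INR g * t)).

Lemma half_angle_bounds (G t : R) :
  0 < G -> 0 < t < PI / (2 * G) -> 0 < G * t < PI / 2.
Proof.
  intros HG [H0 H1]. split; [apply Rmult_lt_0_compat; lra|].
  replace (PI / 2) with (G * (PI / (2 * G))) by (field; lra).
  apply Rmult_lt_compat_l; lra.
Qed.

Lemma t_of_xK (g : nat) (t : R) :
  (0 < g)%nat -> 0 < t < PI / (2 * INR g) -> t_of_x g (x_of_t g t) = t.
Proof.
  intros Hg Ht. apply lt_0_INR in Hg.
  assert (B := half_angle_bounds _ _ Hg Ht).
  unfold t_of_x, x_of_t. rewrite exp_ln by (apply tan_gt_0; lra).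
  rewrite atan_tan by lra. field. lra.
Qed.

Lemma is_derive_x_of_t (g : nat) (t : R) :
  (0 < g)%nat -> 0 < t < PI / (2 * INR g) ->
  is_derive (x_of_t g) t (INR g / (sin (INR g * t) * cos (INR g * t))).
Proof.
  intros Hg Ht. apply lt_0_INR in Hg.
  assert (B := half_angle_bounds _ _ Hg Ht).
  assert (C : 0 < cos (INR g * t)) by (apply cos_gt_0; lra).
  assert (S : 0 < sin (INR g * t)) by (apply sin_gt_0; lra).
  assert (T : 0 < tan (INR g * t)) by (apply tan_gt_0; lra).
  evar_last.
  { apply (is_derive_comp ln (fun t => tan (INR g * t))).
    - apply is_derive_Reals, derivable_pt_lim_ln, T.
    - apply (is_derive_comp tan (fun t => INR g * t)).
      + apply is_derive_tan. lra.
      + auto_derive; [trivial | reflexivity]. }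
  unfold scal; simpl; unfold mult; simpl. unfold tan.
  assert (E := sin2_cos2 (INR g * t)). unfold Rsqr in E.
  set (s := sin _) in *. set (c := cos _) in *.
  replace (s / c * (s / c * 1) + 1) with ((s * s + c * c) / (c * c)) by (field; lra).
  rewrite E. field. lra.
Qed.

(** Near t, [xi] is the composition of [eta] with the smooth inverse [x_of_t], so the second-order
    chain rule applies. *)
Lemma twice_derivable_of_t_of_x (g : nat) (xi : R -> R) :
  (0 < g)%nat ->
  (forall x, twice_derivable (fun x => xi (t_of_x g x)) x) ->
  forall t, 0 < t < PI / (2 * INR g) -> twice_derivable xi t.
Proof.
  intros Hg H t Ht.
  set (eta := fun x => xi (t_of_x g x)) in *.
  assert (L : locally t (fun s => 0 < s < PI / (2 * INR g))).
  { apply (open_and _ _ (open_gt 0) (open_lt _)). exact Ht. }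
  assert (Hg' := lt_0_INR _ Hg).
  assert (B := half_angle_bounds _ _ Hg' Ht).
  assert (C : 0 < cos (INR g * t)) by (apply cos_gt_0; lra).
  assert (S : 0 < sin (INR g * t)) by (apply sin_gt_0; lra).
  set (h1 := fun t => INR g / (sin (INR g * t) * cos (INR g * t))).
  assert (E2 : ex_derive h1 t) by (unfold h1; auto_derive; nra).
  destruct E2 as [h2 E2].
  destruct (derive_comp_twice eta (x_of_t g) h1 h2 t) as [D1 D2].
  { apply filter_forall. intros s. apply H. }
  { apply H. }
  { generalize L. apply filter_imp. intros s. apply is_derive_x_of_t, Hg. }
  { exact E2. }
  assert (K : locally t (fun s => eta (x_of_t g s) = xi s)).
  { generalize L. apply filter_imp. intros s Hs. unfold eta.
    now rewrite t_of_xK. }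
  split.
  - eapply ex_derive_ext_loc; [exact K | eexists; exact D1].
  - eapply ex_derive_ext_loc; [|eexists; exact D2].
    (* Derivatives agree at s only if the functions agree near s, hence the nested
       neighbourhoods. *)
    generalize (locally_locally _ _ K). apply filter_imp. intros s.
    apply Derive_ext_loc.
Qed.

(** Both directions rest on the operator identity [K]. It presupposes that [xi] is twice
    differentiable, so each direction first transports regularity through the change of
    variables. *)
Lemma jacobi_iff_spectral (g m : nat) (lambda : R) (xi : R -> R) :
  (0 < g)%nat ->
  solves_jacobi g m (linear_solution g) (4 * INR g ^ 2 * lambda) xi <->
  solves_spectral_ode g m lambda (fun x => xi (t_of_x g x)).
Proof.
  intros Hg. assert (Hg' := lt_0_INR _ Hg).
  set (eta := fun x => xi (t_of_x g x)).
  assert (K : (forall t, 0 < t < PI / (2 * INR g) -> twice_derivable xi t) ->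
    forall x, let t := t_of_x g x in
    Derive (Derive xi) t
    + 2 * INR g * INR m * cos (2 * INR g * t) / sin (2 * INR g * t) * Derive xi t
    - 2 * INR g * INR m / (sin (2 * INR g * t)) ^ 2
      * ((2 * INR g - 2) * cos (2 * (linear_solution g t - t))
         + 2 * cos (2 * (linear_solution g t - t) + 2 * INR g * t)
           * cos (2 * INR g * t)) * xi t
    + 4 * INR g ^ 2 * lambda * xi t =
    4 * INR g ^ 2 * cosh x ^ 2 *
    (Derive (Derive eta) x - (INR m - 1) * tanh x * Derive eta x
     - INR m * (tanh x) ^ 2 * eta x
     + (lambda + INR m - INR m / INR g) * (eta x / (cosh x) ^ 2))).
  { intros H x t.
    destruct (twice_derivable_t_of_x g xi Hg H x) as [D1 D2].
    fold eta in D1, D2.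
    rewrite (is_derive_unique _ _ _ D1), (is_derive_unique _ _ _ D2).
    destruct (sin_cos_t_of_x g x Hg) as [S C].
    change (eta x) with (xi t). fold t in S, C |- *.
    unfold linear_solution.
    (* As r(t) - t = -2gt, the two angles of the potential become -2gt and -4gt, so everything is
       expressed by sine and cosine of 2gt. *)
    replace (2 * ((1 - 2 * INR g) * t - t) + 2 * INR g * t)
      with (- (2 * INR g * t)) by ring.
    replace (2 * ((1 - 2 * INR g) * t - t))
      with (- (2 * (2 * INR g * t))) by ring.
    rewrite !cos_neg, cos_2a_cos, S, C.
    assert (P := cosh_pos x).
    assert (I := cosh2_tanh2 x).
    set (y := tanh x) in *. set (c := cosh x) in *.
    set (G := INR g) in *. set (M := INR m) in *.
    (* The two sides agree up to a multiple of [c^2 (1 - y^2) - 1]. *)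
    apply Rminus_diag_uniq.
    match goal with |- ?L = 0 => replace L with
      (4 * G ^ 2 * (M - M / G) * xi t * (c ^ 2 * (1 - y ^ 2) - 1))
      by (field; lra) end.
    rewrite I. ring. }
  split.
  - intros H.
    assert (H2 := fun t Ht => proj1 (H t Ht)).
    intros x. destruct (twice_derivable_t_of_x g xi Hg H2 x) as [D1 D2].
    split; [split; eexists; [exact D1 | exact D2]|].
    assert (E := proj2 (H _ (t_of_x_bounds g x Hg))).
    (* The factor 4 g^2 cosh^2 x is positive and can be cancelled. *)
    rewrite (K H2 x) in E.
    apply Rmult_integral in E. destruct E as [E | E]; [exfalso | exact E].
    revert E. apply Rgt_not_eq. apply Rmult_lt_0_compat.
    + apply Rmult_lt_0_compat; [lra | apply pow_lt, Hg'].
    + apply pow_lt, cosh_pos.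
  - intros H t Ht.
    assert (H2 := twice_derivable_of_t_of_x g xi Hg (fun x => proj1 (H x))).
    split; [apply H2, Ht|].
    (* Every t of the interval is the image of [x_of_t g t], so the identity [K] covers it. *)
    assert (E := K H2 (x_of_t g t)). rewrite (t_of_xK g t Hg Ht) in E.
    cbv zeta in E. rewrite E.
    rewrite (proj2 (H (x_of_t g t))). ring.
Qed.

Theorem proposition4p9 (g m : nat) (hgm : admissible g m) :
  ((forall x : R,
      linear_solution g (t_of_x g x) = (1 - 2 * INR g) / INR g * atan (exp x)) /\
   (forall (lambda : R) (xi : R -> R),
      solves_jacobi g m (linear_solution g) (4 * INR g ^ 2 * lambda) xi <->
      solves_spectral_ode g m lambda (fun x : R => xi (t_of_x g x)))) /\
  (forall j : nat, (1 <= j)%nat ->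
     solves_spectral_problem g m
       (INR j * (INR j + INR m) + INR m / INR g - 2 * INR m)
       (fun x : R =>
          1 / cosh x * gegenbauer ((INR m + 2) / 2) (j - 1) (tanh x))).
Proof.
  assert (Hg : (0 < g)%nat) by (unfold admissible in hgm; lia).
  split; [split|].
  - intros x. unfold linear_solution, t_of_x. apply lt_0_INR in Hg. field. lra.
  - intros lambda xi. apply jacobi_iff_spectral, Hg.
  - intros j Hj. apply spectral_solution, Hj.
Qed.
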